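(* Let $D$ be a Dedekind domain which is countable and all of whose nonzero ideals have finite index, let $n\ge1$, and let $(d^+,d^-)$ be a density on $D^n$, extended to subsets of $\hat D^n$ by $d^\pm(Z):=d^\pm(Z\cap D^n)$. Let $\mathcal T$ be a subset of $\mathcal S(D)$ having the zero ideal $0$ as an accumulation point, and let $X\subseteq D^n$. Assume that for every $\sigma\in\mathcal T$ the set $X_\sigma$ has a density and $d(X_\sigma)=\mu(X_\sigma)$. Then $$\lim_{\sigma\to0,\ \sigma\in\mathcal T}d^+(X_\sigma-X)=0$$ holds if and only if $X$ has a density and $d(X)=\mu(\hat X)$.
   Context: $\hat D=\varprojlim_{\mathfrak a}D/\mathfrak a$ (inverse limit over nonzero ideals, each quotient discrete) is a compact topological ring containing $D$ densely; $\hat D^n$ has the product topology, $\hat X$ denotes closure in $\hat D^n$, and $\mu$ is the Haar measure on $\hat D^n$ with $\mu(\hat D^n)=1$. $\mathcal S(D)$ is the set of closed ideals of $\hat D$ (every such ideal is principal), topologized as a quotient of $\hat D$ via the surjection $\rho:\hat D\to\mathcal S(D)$, $x\mapsto x\hat D$; $0$ denotes the zero ideal. For $\sigma\in\mathcal S(D)$ let $\hat\pi_\sigma:\hat D^n\to(\hat D/\sigma)^n$ be the projection, $(\hat D/\sigma)^n$ having the quotient topology, and for $Z\subseteq\hat D^n$ put $Z_\sigma:=\hat\pi_\sigma^{-1}\big(\overline{\hat\pi_\sigma(Z)}\big)$. For a nonzero ideal $\mathfrak a$ of $D$ put $\|\mathfrak a\|=|D/\mathfrak a|$. A density on $D^n$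 is a pair of functions $d^+,d^-:2^{D^n}\to[0,1]$ such that for all $X,Y\subseteq D^n$: (1) $d^-(D^n)=1$; (2) $d^-(X)\le d^+(X)$; (3) $X\subseteq Y$ implies $d^+(X)\le d^+(Y)$ and $d^-(X)\le d^-(Y)$; (4) if $D^n$ is the disjoint union of $X$ and $Y$ then $d^+(X)+d^-(Y)=1$; (5) if $X\cap Y=\emptyset$ then $d^+(X\cup Y)\le d^+(X)+d^+(Y)$ and $d^-(X\cup Y)\ge d^-(X)+d^-(Y)$; (6) $d^\pm(\{x+b\mid x\in X\})=d^\pm(X)$ for every $b\in D^n$; (7) for every nonzero ideal $\mathfrak a$, $d^+(\mathfrak aD^n)=d^-(\mathfrak aD^n)=\|\mathfrak a\|^{-n}$. A set $Z$ has a density if $d^+(Z)=d^-(Z)$, the common value being $d(Z)$. *)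

(* Defs.v *)
From HB Require Import structures.
From mathcomp Require Import all_boot all_order all_algebra.
From mathcomp Require Import generic_quotient fraction mxpoly finmap.
From mathcomp Require Import all_classical all_reals all_analysis.

Set Implicit Arguments.
Unset Strict Implicit.
Unset Printing Implicit Defensive.

Import Order.TTheory GRing.Theory Num.Theory.
Import numFieldNormedType.Exports.

Local Open Scope classical_set_scope.
Local Open Scope ring_scope.
Local Open Scope quotient_scope.

Identity Coercion fun_of_set : set >-> Funclass.

(* The ideals of [ring_quotient] are proper by definition; here the unit ideal
   must be allowed, whence also [comPzRingType]. *)
Record ideal (R : comPzRingType) := Ideal {
  ideal_set :> set R;
  ideal0 : ideal_set 0;
  idealD : forall x y, ideal_set x -> ideal_set y -> ideal_set (x + y);
  idealM : forall r x, ideal_set x -> ideal_set (r * x) }.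

Section QuotientRing.
Variables (R : comPzRingType) (I : ideal R).

Lemma idealN x : I x -> I (- x).
Proof. by move=> Ix; rewrite -mulN1r; exact: idealM. Qed.

Lemma idealB x y : I x -> I y -> I (x - y).
Proof. by move=> Ix Iy; apply: idealD => //; exact: idealN. Qed.

Definition ideal_equiv (x y : R) : bool := `[< I (x - y) >].

Lemma ideal_equiv_is_equiv : equiv_class_of ideal_equiv.
Proof.
split=> [x|x y|y x z]; rewrite /ideal_equiv.
- by apply/asboolP; rewrite subrr; exact: ideal0.
- by apply/asbool_equiv_eq; split=> /idealN; rewrite opprB.
- move=> /asboolP xy /asboolP yz; apply/asboolP.
  by rewrite -(subrKA y); exact: idealD.
Qed.

Canonical ideal_equiv_equiv := EquivRelPack ideal_equiv_is_equiv.
Canonical ideal_equiv_encModRel := defaultEncModRel ideal_equiv.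

Definition quot : Type := {eq_quot ideal_equiv}.

HB.instance Definition _ : EqQuotient R ideal_equiv quot := EqQuotient.on quot.
HB.instance Definition _ := Choice.on quot.

Lemma quot_eqP x y : (\pi_quot x = \pi_quot y) <-> I (x - y).
Proof.
split=> [/eqmodP/asboolP //|h]; exact/eqmodP/asboolP.
Qed.

Lemma quot_reprP x : I (x - repr (\pi_quot x)).
Proof. by apply/quot_eqP; rewrite reprK. Qed.

Definition quot_add : quot -> quot -> quot := lift_op2 quot +%R.
Definition quot_opp : quot -> quot := lift_op1 quot -%R.
Definition quot_mul : quot -> quot -> quot := lift_op2 quot *%R.

Lemma pi_quot_add x y : \pi_quot (x + y) = quot_add (\pi_quot x) (\pi_quot y).
Proof.
unlock quot_add; apply/quot_eqP; rewrite opprD addrACA.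
by apply: idealD; exact: quot_reprP.
Qed.

Lemma pi_quot_opp x : \pi_quot (- x) = quot_opp (\pi_quot x).
Proof. by unlock quot_opp; apply/quot_eqP; rewrite -opprD; apply: idealN; exact: quot_reprP. Qed.

Lemma pi_quot_mul x y : \pi_quot (x * y) = quot_mul (\pi_quot x) (\pi_quot y).
Proof.
unlock quot_mul; apply/quot_eqP; set x' := repr _; set y' := repr _.
rewrite -(subrKA (x * y')) -mulrBr -mulrBl; apply: idealD.
  by apply: idealM; exact: quot_reprP.
by rewrite mulrC; apply: idealM; exact: quot_reprP.
Qed.

Lemma quot_addA : associative quot_add.
Proof.
by move=> x y z; rewrite -[x]reprK -[y]reprK -[z]reprK -!pi_quot_add addrA.
Qed.

Lemma quot_addC : commutative quot_add.
Proof. by move=> x y; rewrite -[x]reprK -[y]reprK -!pi_quot_add addrC. Qed.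

Lemma quot_add0 : left_id (\pi_quot 0) quot_add.
Proof. by move=> x; rewrite -[x]reprK -!pi_quot_add add0r. Qed.

Lemma quot_addN : left_inverse (\pi_quot 0) quot_opp quot_add.
Proof. by move=> x; rewrite -[x]reprK -pi_quot_opp -pi_quot_add addNr. Qed.

HB.instance Definition _ :=
  GRing.isZmodule.Build quot quot_addA quot_addC quot_add0 quot_addN.

Lemma quot_mulA : associative quot_mul.
Proof.
by move=> x y z; rewrite -[x]reprK -[y]reprK -[z]reprK -!pi_quot_mul mulrA.
Qed.

Lemma quot_mulC : commutative quot_mul.
Proof. by move=> x y; rewrite -[x]reprK -[y]reprK -!pi_quot_mul mulrC. Qed.

Lemma quot_mul1 : left_id (\pi_quot 1) quot_mul.
Proof. by move=> x; rewrite -[x]reprK -!pi_quot_mul mul1r. Qed.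

Lemma quot_mulDl : left_distributive quot_mul quot_add.
Proof.
move=> x y z; rewrite -[x]reprK -[y]reprK -[z]reprK.
by rewrite -!(pi_quot_mul, pi_quot_add) mulrDl.
Qed.

HB.instance Definition _ := GRing.Zmodule_isComPzRing.Build quot
  quot_mulA quot_mulC quot_mul1 quot_mulDl.

Lemma piquotD x y : \pi_quot (x + y) = \pi_quot x + \pi_quot y.
Proof. exact: pi_quot_add. Qed.

Lemma piquotN x : \pi_quot (- x) = - \pi_quot x.
Proof. exact: pi_quot_opp. Qed.

Lemma piquotM x y : \pi_quot (x * y) = \pi_quot x * \pi_quot y.
Proof. exact: pi_quot_mul. Qed.

End QuotientRing.

Section Dedekind.
Variable D : idomainType.

Definition nonzero_ideal (I : ideal D) := exists2 x, I x & x != 0.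

Definition prime_ideal (I : ideal D) :=
  ~ I 1 /\ forall x y, I (x * y) -> I x \/ I y.

Definition maximal_ideal (I : ideal D) :=
  ~ I 1 /\ forall J : ideal D, I `<=` J -> J 1 \/ J `<=` I.

Definition noetherian := forall I : ideal D,
  exists (m : nat) (g : 'I_m -> D),
    I = [set x | exists c : 'I_m -> D, x = \sum_i c i * g i] :> set D.

Definition integrally_closed := forall u : {fraction D},
  integralOver (@tofrac D) u -> exists x : D, u = tofrac x.

(* Fields are not excluded: for them the completion below is the zero ring. *)
Definition dedekind_domain := [/\ noetherian, integrally_closed &
  forall I : ideal D, nonzero_ideal I -> prime_ideal I -> maximal_ideal I].

Record nzideal := NzIdeal {
  nzideal_val :> ideal D;
  nzidealP : nonzero_ideal nzideal_val }.

HB.instance Definition _ := gen_eqMixin nzideal.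
HB.instance Definition _ := gen_choiceMixin nzideal.

Definition finite_quotients := forall a : nzideal, finite_set [set: quot a].

Definition ideal_norm (a : nzideal) : nat := #|` fset_set [set: quot a]|.

(* The canonical projection D/a -> D/b; only meaningful when a `<=` b. *)
Definition quot_proj (a b : nzideal) (u : quot a) : quot b := \pi_(quot b) (repr u).

Definition dquot (a : nzideal) : topologicalType := discrete_topology (quot a).

Definition compatible : set (prod_topology dquot) :=
  [set x | forall a b : nzideal, a `<=` b -> quot_proj b (x a : quot a) = x b].

(* The inverse limit of the discrete rings D/a, with the topology induced by the
   product; the ring operations are componentwise. *)
Definition completion : Type := set_type compatible.

HB.instance Definition _ := Topological.on completion.

Definition comp_coord (x : completion) (a : nzideal) : quot a := val x a.

Lemma quot_projE (a b : nzideal) x : a `<=` b ->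
  quot_proj b (\pi_(quot a) x) = \pi_(quot b) x.
Proof.
move=> ab; apply/quot_eqP; rewrite -opprB; apply: idealN; apply: ab.
exact: quot_reprP.
Qed.

Lemma comp_coordP (x : completion) (a b : nzideal) : a `<=` b ->
  quot_proj b (comp_coord x a) = comp_coord x b.
Proof. by move=> ab; have := set_mem (valP x); apply. Qed.

Lemma completion_ext (x y : completion) :
  (forall a, comp_coord x a = comp_coord y a) -> x = y.
Proof. by move=> xy; apply: val_inj; apply: functional_extensionality_dep. Qed.

Definition comp_mk (x : forall a : nzideal, quot a)
    (xP : forall a b : nzideal, a `<=` b -> quot_proj b (x a) = x b) :
    completion :=
  exist _ (x : prod_topology dquot) (mem_set (xP : compatible x)).

Definition to_completion (x : D) : completion :=
  comp_mk (fun a b => @quot_projE a b x).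

Lemma comp_add_subproof (x y : completion) (a b : nzideal) : a `<=` b ->
  quot_proj b (comp_coord x a + comp_coord y a) = comp_coord x b + comp_coord y b.
Proof.
move=> ab; rewrite -(comp_coordP x ab) -(comp_coordP y ab).
rewrite -[comp_coord x a]reprK -[comp_coord y a]reprK -piquotD.
by rewrite !quot_projE// piquotD.
Qed.

Lemma comp_opp_subproof (x : completion) (a b : nzideal) : a `<=` b ->
  quot_proj b (- comp_coord x a) = - comp_coord x b.
Proof.
move=> ab; rewrite -(comp_coordP x ab).
by rewrite -[comp_coord x a]reprK -piquotN !quot_projE// piquotN.
Qed.

Lemma comp_mul_subproof (x y : completion) (a b : nzideal) : a `<=` b ->
  quot_proj b (comp_coord x a * comp_coord y a) = comp_coord x b * comp_coord y b.
Proof.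
move=> ab; rewrite -(comp_coordP x ab) -(comp_coordP y ab).
rewrite -[comp_coord x a]reprK -[comp_coord y a]reprK -piquotM.
by rewrite !quot_projE// piquotM.
Qed.

Definition comp_add x y := comp_mk (comp_add_subproof x y).
Definition comp_opp x := comp_mk (comp_opp_subproof x).
Definition comp_mul x y := comp_mk (comp_mul_subproof x y).

Lemma comp_addA : associative comp_add.
Proof. by move=> x y z; apply: completion_ext => a; exact: addrA. Qed.

Lemma comp_addC : commutative comp_add.
Proof. by move=> x y; apply: completion_ext => a; exact: addrC. Qed.

Lemma comp_add0 : left_id (to_completion 0) comp_add.
Proof. by move=> x; apply: completion_ext => a; exact: add0r. Qed.

Lemma comp_addN : left_inverse (to_completion 0) comp_opp comp_add.
Proof. by move=> x; apply: completion_ext => a; exact: addNr. Qed.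

HB.instance Definition _ :=
  GRing.isZmodule.Build completion comp_addA comp_addC comp_add0 comp_addN.

Lemma comp_mulA : associative comp_mul.
Proof. by move=> x y z; apply: completion_ext => a; exact: mulrA. Qed.

Lemma comp_mulC : commutative comp_mul.
Proof. by move=> x y; apply: completion_ext => a; exact: mulrC. Qed.

Lemma comp_mul1 : left_id (to_completion 1) comp_mul.
Proof. by move=> x; apply: completion_ext => a; exact: mul1r. Qed.

Lemma comp_mulDl : left_distributive comp_mul comp_add.
Proof. by move=> x y z; apply: completion_ext => a; exact: mulrDl. Qed.

HB.instance Definition _ := GRing.Zmodule_isComPzRing.Build completion
  comp_mulA comp_mulC comp_mul1 comp_mulDl.

HB.instance Definition _ := isPointed.Build completion 0.

Lemma comp_coordM (x y : completion) a :
  comp_coord (x * y) a = comp_coord x a * comp_coord y a.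
Proof. by []. Qed.

Lemma proj_nbhs (x : prod_topology dquot) (a : nzideal) :
  nbhs x [set y | y a = x a].
Proof.
apply: (@proj_continuous _ dquot a x [set u | u = x a]).
exact: (@discrete_set1 (discrete_topology (quot a))).
Qed.

Lemma closed_compatible : closed compatible.
Proof.
move=> x clx a b ab.
have [y [yP [/= <- <-]]] := clx _ (filterI (proj_nbhs x a) (proj_nbhs x b)).
exact: yP.
Qed.

Lemma compact_completion : finite_quotients -> compact [set: completion].
Proof.
move=> fin F FF _.
pose v (x : completion) : prod_topology dquot := val x.
have cK : compact compatible.
  have /subclosed_compact : compact [set: prod_topology dquot].
    have -> : [set: prod_topology dquot] = [set x | forall a, setT (x a)].
      by apply/seteqP; split.
    apply: (@tychonoff nzideal dquot (fun=> setT)) => a.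
    exact/finite_compact/fin.
  by apply; [exact: closed_compatible | exact: subsetT].
have FK : F (v @^-1` compatible).
  by apply: filterE => x; have /set_mem := valP x.
have [p [Kp clp]] := cK _ (fmap_proper_filter v FF) FK.
exists (exist _ p (mem_set Kp)); split => // A B FA [_ [[W oW <-] Wp WB]].
have FA' : F (v @^-1` (v @` A)) by apply: filterS FA => x Ax; exists x.
have [_ [[x Ax <-] Wx]] := clp _ W FA' (open_nbhs_nbhs (conj oW Wp)).
by exists x; split => //; exact: WB.
Qed.

Lemma coord_nbhs (x : completion) a :
  nbhs x [set y | comp_coord y a = comp_coord x a].
Proof. exact: (initial_continuous (proj_nbhs (val x) a)). Qed.

Lemma hausdorff_completion : hausdorff_space completion.
Proof.
move=> x y xy; apply: completion_ext => a.
by have [z [/= <- <-]] := xy _ _ (coord_nbhs x a) (coord_nbhs y a).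
Qed.

Lemma continuous_completion (f : completion -> completion) :
  (forall x a, \forall y \near x, comp_coord (f y) a = comp_coord (f x) a) ->
  continuous f.
Proof.
move=> fP; apply: continuous_comp_initial => x.
have FF : Filter ((set_val \o f : completion -> prod_topology dquot) @ x).
  exact: (@fmap_filter _ _ _ (nbhs x) (nbhs_filter x)).
apply/cvg_sup => a U.
move=> [_ [[W oW <-] Wx WU]].
apply: filterS (fP x a) => y /= fyx; apply: WU => /=.
have : W (comp_coord (f x) a) := Wx.
by rewrite -fyx.
Qed.

Definition principal_set (x : completion) : set completion :=
  range (fun z => x * z).

Lemma closed_principal (x : completion) :
  finite_quotients -> closed (principal_set x).
Proof.
move=> fin; apply: compact_closed; first exact: hausdorff_completion.
apply: continuous_compact (compact_completion fin).
apply: continuous_subspaceT; apply: continuous_completion => y a.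
by apply: filterS (coord_nbhs y a) => z /= zy; rewrite !comp_coordM zy.
Qed.

Definition principal_ideal (x : completion) : ideal completion.
Proof.
refine (@Ideal _ (principal_set x) _ _ _).
- by exists 0; rewrite // mulr0.
- by move=> _ _ [y _ <-] [z _ <-]; exists (y + z); rewrite // mulrDr.
- by move=> r _ [y _ <-]; exists (r * y); rewrite // mulrCA.
Defined.

Record closed_ideal := ClosedIdeal {
  closed_ideal_val :> ideal completion;
  closed_idealP : closed closed_ideal_val }.

(* The set S(D); the finiteness hypothesis is needed for [rho] below to take
   closed values, hence for the quotient topology. *)
Definition closed_ideals (fin : finite_quotients) : Type := closed_ideal.

Section ClosedIdeals.
Variable fin : finite_quotients.

Definition rho (x : completion) : closed_ideals fin :=
  @ClosedIdeal (principal_ideal x) (@closed_principal x fin).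

HB.instance Definition _ := gen_eqMixin (closed_ideals fin).
HB.instance Definition _ := gen_choiceMixin (closed_ideals fin).

Definition open_closed_ideals (U : set (closed_ideals fin)) :=
  open (rho @^-1` U).

Lemma open_closed_idealsT : open_closed_ideals setT.
Proof. by rewrite /open_closed_ideals preimage_setT; exact: openT. Qed.

Lemma open_closed_idealsI : setI_closed open_closed_ideals.
Proof. by move=> U V oU oV; exact: openI. Qed.

Lemma open_closed_ideals_bigU (I : Type) (f : I -> set (closed_ideals fin)) :
  (forall i, open_closed_ideals (f i)) -> open_closed_ideals (\bigcup_i f i).
Proof. by move=> of_; apply: bigcup_open => i _; exact: of_. Qed.

HB.instance Definition _ := isOpenTopological.Build (closed_ideals fin)
  open_closed_idealsT open_closed_idealsI open_closed_ideals_bigU.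

Definition zero_ideal : ideal completion.
Proof.
refine (@Ideal _ [set 0] _ _ _) => //.
- by move=> _ _ -> ->; rewrite /= addr0.
- by move=> r _ ->; rewrite /= mulr0.
Defined.

Lemma closed_zero : closed zero_ideal.
Proof. exact/accessible_closed_set1/hausdorff_accessible/hausdorff_completion. Qed.

Definition zero_closed_ideal : closed_ideals fin :=
  @ClosedIdeal zero_ideal closed_zero.

End ClosedIdeals.

Section Vectors.
Variable n : nat.

Definition to_completion_vec (v : 'rV[D]_n) : 'rV[completion]_n :=
  map_mx to_completion v.

Definition quot_vec (s : ideal completion) : Type := 'rV[quot s]_n.

Definition quot_vec_repr (s : ideal completion) (u : quot_vec s) :
  'rV[completion]_n := map_mx repr u.

Definition quot_vec_pi (s : ideal completion) (v : 'rV[completion]_n) :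
  quot_vec s := map_mx \pi_(quot s) v.

Lemma quot_vec_reprK s : cancel (@quot_vec_repr s) (@quot_vec_pi s).
Proof. by move=> u; apply/rowP => i; rewrite !mxE reprK. Qed.

HB.instance Definition _ (s : ideal completion) :=
  isQuotient.Build 'rV[completion]_n (quot_vec s) (@quot_vec_reprK s).

(* Z_s = pi_s^-1 (closure (pi_s Z)) *)
Definition ideal_closure (s : ideal completion) (Z : set 'rV[completion]_n) :
    set 'rV[completion]_n :=
  let pi_s : 'rV[completion]_n -> quotient_topology (quot_vec s) :=
    @quot_vec_pi s in
  pi_s @^-1` closure (pi_s @` Z).

Definition ideal_vec (a : nzideal) : set 'rV[D]_n :=
  [set v | exists (m : nat) (c : 'I_m -> D) (w : 'I_m -> 'rV[D]_n),
     (forall k, a (c k)) /\ v = \sum_k c k *: w k].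

Record is_density (R : realType) (dp dm : set 'rV[D]_n -> R) : Prop := {
  density_rangep : forall X, 0 <= dp X <= 1;
  density_rangem : forall X, 0 <= dm X <= 1;
  densityT : dm setT = 1;
  density_le : forall X, dm X <= dp X;
  density_subp : forall X Y, X `<=` Y -> dp X <= dp Y;
  density_subm : forall X Y, X `<=` Y -> dm X <= dm Y;
  densityC : forall X Y, X `&` Y = set0 -> X `|` Y = setT -> dp X + dm Y = 1;
  densityUp : forall X Y, X `&` Y = set0 -> dp (X `|` Y) <= dp X + dp Y;
  densityUm : forall X Y, X `&` Y = set0 -> dm X + dm Y <= dm (X `|` Y);
  density_transp : forall X b, dp [set x + b | x in X] = dp X;
  density_transm : forall X b, dm [set x + b | x in X] = dm X;
  density_idealp : forall a : nzideal,
    dp (ideal_vec a) = ((ideal_norm a)%:R ^+ n)^-1;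
  density_idealm : forall a : nzideal,
    dm (ideal_vec a) = ((ideal_norm a)%:R ^+ n)^-1 }.

(* The extension d(Z) := d(Z `&` D^n) to subsets Z of the completion. *)
Definition density_ext (R : realType) (d : set 'rV[D]_n -> R)
    (Z : set 'rV[completion]_n) : R := d (to_completion_vec @^-1` Z).

Definition borel_completion :=
  g_sigma_algebraType (@open 'rV[completion]_n).

(* Haar probability measures; the completion being compact and metrizable (D is
   countable), regularity of Borel probability measures is automatic. *)
Definition is_haar (R : realType) (mu : probability borel_completion R) :=
  forall (b : 'rV[completion]_n) (A : set 'rV[completion]_n),
    measurable (A : set borel_completion) ->
    mu [set x + b | x in A] = mu A.

End Vectors.

End Dedekind.

Arguments zero_closed_ideal {D} fin.
Arguments rho {D} fin.
Arguments to_completion {D}.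
Arguments to_completion_vec {D n}.
Arguments is_density {D n R}.
Arguments is_haar {D n R}.

(* Main.v *)
(* If Y contains X and has a density, then d+(Y - X) = d(Y) - d-(X). For
   Y = X_sigma this reads d+(X_sigma - X) = mu(X_sigma) - d-(X), and the point
   is that mu(X_sigma) tends to mu(closure X) as sigma tends to 0: once sigma
   lies in the closure of a nonzero ideal a, X_sigma lies between the closure of
   X and the clopen set X + (closure of a)^n, and along a countable cofinal chain
   of ideals a (D is countable) these clopen sets decrease to the closure of X.
   So d+(X_sigma - X) tends to mu(closure X) - d-(X); as
   d-(X) <= d+(X) <= mu(closure X), this limit is 0 if and only if the three
   numbers coincide. *)
Require Import Defs.
From HB Require Import structures.
From mathcomp Require Import all_boot all_order all_algebra.
From mathcomp Require Import all_classical all_reals all_analysis.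

Set Implicit Arguments.
Unset Strict Implicit.
Unset Printing Implicit Defensive.

Import Order.TTheory GRing.Theory Num.Theory.
Import numFieldNormedType.Exports.

Local Open Scope classical_set_scope.
Local Open Scope ring_scope.

Lemma within_dnbhs_proper (U : topologicalType) (A : set U) (x : U) :
  limit_point A x -> ProperFilter (within A x^').
Proof.
move=> Ax; apply: Build_ProperFilter_ex => B /Ax[y [yx Ay ABy]].
by exists y; exact: ABy.
Qed.

Section Ideals.
Variable R : comPzRingType.
Implicit Types I J : ideal R.

Lemma ideal_ext I J : I = J :> set R -> I = J.
Proof.
case: I J => [I I0 ID IM] [J J0 JD JM] /= IJ; subst J.
by congr Ideal; exact: Prop_irrelevance.
Qed.

Lemma ideal1 I x : I 1 -> I x.
Proof. by move=> /(idealM x); rewrite mulr1. Qed.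

Definition multiples (x : R) : ideal R.
Proof.
refine (@Ideal R (range ( *%R x)) _ _ _).
- by exists 0; rewrite // mulr0.
- by move=> _ _ [y _ <-] [z _ <-]; exists (y + z); rewrite // mulrDr.
- by move=> r _ [y _ <-]; exists (r * y); rewrite // mulrCA.
Defined.

Lemma sub_multiples I x : I x -> multiples x `<=` I.
Proof. by move=> Ix _ [y _ <-]; rewrite mulrC; exact: idealM. Qed.

End Ideals.

Section NonzeroIdeals.
Variable D : idomainType.
Implicit Types a b c : nzideal D.

Definition nzmultiples (x : D) (x0 : x != 0) : nzideal D.
Proof.
refine (@NzIdeal D (multiples x) _).
by exists x => //; exists 1; rewrite // mulr1.
Defined.

Lemma nzideal_directed a b : exists2 c : nzideal D, c `<=` a & c `<=` b.
Proof.
have [x ax x0] := nzidealP a; have [y b_y y0] := nzidealP b.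
exists (nzmultiples (mulf_neq0 x0 y0)); apply: sub_multiples.
  by rewrite mulrC; exact: idealM.
exact: idealM.
Qed.

Lemma filter_from_nzideal (U : Type) (B : nzideal D -> set U) :
  (forall a b, a `<=` b -> B a `<=` B b) -> Filter (filter_from setT B).
Proof.
move=> Bmono; apply: filter_fromT_filter.
  by exists (nzmultiples (oner_neq0 D)).
move=> a b; have [c ca cb] := nzideal_directed a b.
by exists c; rewrite subsetI; split; exact: Bmono.
Qed.

Definition cofinal_nzideals (J : Type) (a : J -> nzideal D) :=
  forall b, exists j, a j `<=` b.

Lemma countable_cofinal_nzideals : countable [set: D] ->
  exists2 a : nat -> nzideal D,
    forall i j, (i <= j)%N -> a j `<=` a i & cofinal_nzideals a.
Proof.
move=> cD; have /pfcard_geP[nz0|[e]] : countable [set x : D | x != 0].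
- exact: sub_countable (card_leT _) cD.
- suff : [set x : D | x != 0] 1 by rewrite nz0.
  exact: oner_neq0.
have prod_e0 i : \prod_(k < i) e k != 0.
  by apply/prodf_neq0 => k _; exact: (@funS _ _ _ _ e).
exists (fun i => nzmultiples (prod_e0 i)) => [i j ij|b].
  apply: sub_multiples; exists (\prod_(i <= k < j) e k) => //.
  by rewrite -2!(big_mkord xpredT e) -big_cat_nat.
have [x bx x0] := nzidealP b.
have [i _ eix] := @surj _ _ _ _ e x x0.
exists i.+1; apply: sub_multiples; rewrite big_ord_recr /= eix.
exact: idealM.
Qed.

End NonzeroIdeals.

Section Completion.
Variable D : idomainType.
Implicit Types (a b : nzideal D) (x y : completion D).

Lemma comp_coordS a b x y : a `<=` b ->
  comp_coord x a = comp_coord y a -> comp_coord x b = comp_coord y b.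
Proof. by move=> ab xy; rewrite -!(comp_coordP _ ab) xy. Qed.

Lemma nbhs_completionE x :
  nbhs x =
  filter_from setT (fun a => [set y | comp_coord y a = comp_coord x a]).
Proof.
set F := filter_from _ _.
have FF : Filter F.
  by apply: filter_from_nzideal => a b ab y; exact: comp_coordS.
apply/seteqP; split=> [V [_ [[W oW <-] Wx WV]]|V [a _ aV]]; last first.
  exact: filterS aV (coord_nbhs x a).
pose val_completion : completion D -> prod_topology (@dquot D) := set_val.
have Fx : val_completion @ F --> val_completion x.
  apply/cvg_sup => a U [_ [[W' oW' <-] W'x W'U]].
  exists a => // y /= yx; apply: W'U => /=.
  have : W' (comp_coord x a) := W'x.
  by rewrite -yx.
have [a _ aW] := Fx _ (open_nbhs_nbhs (conj oW Wx)).
by exists a => // y /aW; exact: WV.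
Qed.

(* The closure of a in the completion. *)
Definition coord_kernel a : set (completion D) := [set x | comp_coord x a = 0].

Lemma coord_kernelB a x y :
  coord_kernel a (x - y) <-> comp_coord x a = comp_coord y a.
Proof.
have -> : coord_kernel a (x - y) = (comp_coord x a - comp_coord y a = 0) by [].
by split=> [/subr0_eq|->]; rewrite ?subrr.
Qed.

Lemma open_coord_kernel a : open (coord_kernel a).
Proof.
rewrite openE => x ax; rewrite /interior nbhs_completionE.
by exists a => // y yx; exact: etrans yx ax.
Qed.

Lemma principal_set_sub_coord_kernel a x :
  principal_set x `<=` coord_kernel a <-> coord_kernel a x.
Proof.
split=> [|ax _ [y _ <-]]; first by apply; exists 1; rewrite // mulr1.
by rewrite /coord_kernel /= comp_coordM ax mul0r.
Qed.

Lemma completion_trivial x y : (forall a, a 1) -> x = y.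
Proof.
move=> a1; apply: completion_ext => a.
rewrite -[comp_coord x a]reprK -[comp_coord y a]reprK; apply/quot_eqP.
exact/ideal1/a1.
Qed.

(* For a proper nonzero ideal a and 0 != t in a, the ideal ((x - y) t) separates
   x from y. The hypothesis excludes fields, whose completion is trivial. *)
Lemma to_completion_inj a :
  ~ a 1 -> injective (to_completion : D -> completion D).
Proof.
move=> a1 x y xy; apply/eqP; rewrite -subr_eq0; apply/negP => /negP xy0.
have [t a_t t0] := nzidealP a.
have /quot_eqP[u _] :=
  congr1 (fun z => comp_coord z (nzmultiples (mulf_neq0 xy0 t0))) xy.
rewrite -mulrA -[RHS]mulr1 => /(mulfI xy0) tu1; apply: a1.
by rewrite -tu1 mulrC; exact: idealM.
Qed.

End Completion.

Section ClosedIdeals.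
Variables (D : idomainType) (fin : finite_quotients D).
Implicit Type s : closed_ideals fin.

Lemma closed_ideal_ext (s t : closed_ideal D) :
  s = t :> set (completion D) -> s = t.
Proof.
case: s t => [s cs] [t ct] /= /ideal_ext st; subst t.
by congr ClosedIdeal; exact: Prop_irrelevance.
Qed.

Lemma proper_nzideal_ex s :
  s != zero_closed_ideal fin -> exists a : nzideal D, ~ a 1.
Proof.
apply: contra_neqP => /forallNP a1; apply: closed_ideal_ext.
apply/seteqP; split=> x => [_|->]; last exact: ideal0.
by apply: completion_trivial => a; exact: contrapT.
Qed.

Lemma nbhs_zero_closed_ideal (a : nzideal D) :
  \forall s \near zero_closed_ideal fin,
    (s : closed_ideal D) `<=` coord_kernel a.
Proof.
apply: open_nbhs_nbhs; split; last by move=> x ->.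
rewrite /open /= /open_closed_ideals; have := open_coord_kernel a.
by congr open; apply/seteqP; split=> x /principal_set_sub_coord_kernel.
Qed.

End ClosedIdeals.

Section CompletionVectors.
Variables (D : idomainType) (n : nat).
Implicit Types (a b : nzideal D) (s : ideal (completion D)).
Implicit Types (v w : 'rV[completion D]_n) (A Z : set 'rV[completion D]_n).

Definition vec_coord a v : 'rV[quot a]_n := map_mx (fun x => comp_coord x a) v.

Lemma vec_coordP a v w :
  vec_coord a v = vec_coord a w <->
  forall i j, comp_coord (v i j) a = comp_coord (w i j) a.
Proof.
split=> [/matrixP vw i j|vw]; first by have := vw i j; rewrite !mxE.
by apply/matrixP => i j; rewrite !mxE.
Qed.

Lemma vec_coordS a b v w : a `<=` b ->
  vec_coord a v = vec_coord a w -> vec_coord b v = vec_coord b w.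
Proof.
move=> ab /vec_coordP vw; apply/vec_coordP => i j.
exact: comp_coordS (vw i j).
Qed.

Lemma nbhs_vec_completionE v :
  nbhs v = filter_from setT (fun a => [set w | vec_coord a w = vec_coord a v]).
Proof.
set F := filter_from _ _.
have FF : Filter F.
  by apply: filter_from_nzideal => a b ab w; exact: vec_coordS.
apply/seteqP; split=> [V [P vP PV]|V [a _ aV]].
  have FP i j : F [set w | P i j (w i j)].
    have := vP i j; rewrite nbhs_completionE => -[a _ aP].
    by exists a => // w /= /vec_coordP wv; exact: aP.
  have [a _ aP] := filter_forall _ (fun i => filter_forall _ (FP i)).
  by exists a => // w /aP; exact: PV.
exists (fun i j => [set y | comp_coord y a = comp_coord (v i j) a]).
  by move=> i j; exact: coord_nbhs.
by move=> w /= wv; apply: aV; exact/vec_coordP.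
Qed.

(* This is Z + (closure of a)^n. *)
Definition thickening a Z := vec_coord a @^-1` (vec_coord a @` Z).

Lemma closed_thickening a Z : closed (thickening a Z).
Proof.
rewrite -openC openE => v Zv; rewrite /interior nbhs_vec_completionE.
by exists a => // w /= wv; rewrite /thickening /= wv.
Qed.

Lemma sub_thickening a Z : Z `<=` thickening a Z.
Proof. exact: preimage_image. Qed.

Lemma thickeningS a b Z : a `<=` b -> thickening a Z `<=` thickening b Z.
Proof. by move=> ab v [w Zw wv]; exists w => //; exact: vec_coordS wv. Qed.

Lemma closure_bigcap_thickening (J : Type) (a : J -> nzideal D) Z :
  cofinal_nzideals a -> closure Z = \bigcap_j thickening (a j) Z.
Proof.
move=> cofin; apply/seteqP; split=> v.
  move=> clv j _; apply: closed_thickening.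
  exact: closureS (@sub_thickening (a j) Z) _ clv.
move=> vZ V; rewrite nbhs_vec_completionE => -[b _ bV].
have [j ajb] := cofin b; have [z Zz zv] := vZ j I.
by exists z; split=> //; apply: bV; exact: vec_coordS zv.
Qed.

Lemma pi_quot_vecE s :
  \pi_(quotient_topology (quot_vec n s))%qT = @quot_vec_pi D n s.
Proof. by rewrite generic_quotient.pi.unlock. Qed.

Lemma sub_ideal_closure s Z : Z `<=` ideal_closure s Z.
Proof. by move=> v Zv; apply: subset_closure; exists v. Qed.

Lemma closed_ideal_closure s Z : closed (ideal_closure s Z).
Proof.
apply: preimage_closed; last exact: closed_closure.
by move=> v _; rewrite -pi_quot_vecE; exact: pi_continuous.
Qed.

Lemma closure_sub_ideal_closure s Z : closure Z `<=` ideal_closure s Z.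
Proof.
move=> v clv; apply: closed_ideal_closure.
exact: closureS (@sub_ideal_closure s Z) _ clv.
Qed.

Lemma ideal_closure_min s Z A : closed A ->
  (forall v w, quot_vec_pi s v = quot_vec_pi s w -> A v -> A w) ->
  Z `<=` A -> ideal_closure s Z `<=` A.
Proof.
move=> cA satA ZA v.
pose pi_s : 'rV_n -> quotient_topology (quot_vec n s) := @quot_vec_pi D n s.
pose B : set (quotient_topology (quot_vec n s)) := @quot_vec_repr D n s @^-1` A.
have piB : pi_s @^-1` B = A.
  by apply/seteqP; split=> w; apply: satA; rewrite quot_vec_reprK.
have cB : closed B.
  have oCB : open (pi_s @^-1` (~` B)) by rewrite -preimage_setC piB openC.
  by rewrite -openC /open /= /quotient_open pi_quot_vecE.
rewrite -piB => clv; apply: cB; apply: closureS clv.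
by rewrite image_sub piB.
Qed.

Lemma ideal_closure_sub_thickening s a Z :
  s `<=` coord_kernel a -> ideal_closure s Z `<=` thickening a Z.
Proof.
move=> sa; apply: ideal_closure_min (@sub_thickening a Z).
  exact: closed_thickening.
move=> v w /matrixP vw; rewrite /thickening /=; congr image; apply/vec_coordP.
move=> i j; apply/coord_kernelB/sa/quot_eqP.
by have := vw i j; rewrite !mxE.
Qed.

Lemma preimage_image_to_completion_vec a (X : set 'rV[D]_n) :
  ~ a 1 -> to_completion_vec @^-1` (to_completion_vec @` X) = X.
Proof.
move=> /to_completion_inj inj; apply/seteqP; split; last exact: preimage_image.
move=> v [w Xw /matrixP wv]; have -> // : v = w.
apply/matrixP => i j; apply: inj.
by have := wv i j; rewrite !mxE.
Qed.

End CompletionVectors.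

Section Measure.
Variables (R : realType) (D : idomainType) (n : nat).
Variable mu : {finite_measure set (borel_completion D n) -> \bar R}.
Implicit Types A B Z : set 'rV[completion D]_n.

Lemma closed_measurable_completion A :
  closed A -> measurable (A : set (borel_completion D n)).
Proof.
move=> cA; rewrite -[A]setCK; apply: measurableC.
by apply: sub_sigma_algebra; rewrite openC.
Qed.

Lemma fin_num_measure_closed A : closed A -> mu A \is a fin_num.
Proof. by move=> /closed_measurable_completion; exact: fin_num_measure. Qed.

Lemma le_fine_measure_closed A B :
  closed A -> closed B -> A `<=` B -> fine (mu A) <= fine (mu B).
Proof.
move=> cA cB AB; apply: fine_le; rewrite ?fin_num_measure_closed//.
have mA := closed_measurable_completion cA.
have mB := closed_measurable_completion cB.
by apply: le_measure; rewrite ?inE.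
Qed.

Lemma measure_thickening_lt Z (e : R) : countable [set: D] -> 0 < e ->
  exists a : nzideal D, fine (mu (thickening a Z)) < fine (mu (closure Z)) + e.
Proof.
move=> /countable_cofinal_nzideals[a adec acof] e0.
have mth k : measurable (thickening (a k) Z : set (borel_completion D n)).
  exact: (closed_measurable_completion (@closed_thickening _ _ (a k) Z)).
have mucvg : mu \o (fun k => thickening (a k) Z) @ \oo --> mu (closure Z).
  rewrite (closure_bigcap_thickening _ acof); apply: nonincreasing_cvg_mu => //.
  - by rewrite ltey_eq fin_num_measure.
  - exact: bigcapT_measurable.
  - by move=> i j ij; apply/subsetPset/thickeningS/adec.
rewrite -(fineK (fin_num_measure_closed (@closed_closure _ Z))) in mucvg.
have [k _ kP] : \forall k \near \oo,
    fine (mu (thickening (a k) Z)) < fine (mu (closure Z)) + e.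
  by apply: cvgr_lt (fine_cvg mucvg) _ _; rewrite ltrDl.
by exists (a k); exact: kP (leqnn k).
Qed.

Lemma cvg_measure_ideal_closure (fin : finite_quotients D)
    (F : set_system (closed_ideals fin)) {FF : Filter F} Z :
  countable [set: D] -> F --> zero_closed_ideal fin ->
  fine (mu (ideal_closure s Z)) @[s --> F] --> fine (mu (closure Z)).
Proof.
move=> cD F0; apply/cvgrPdist_lt => e e0.
have [a ae] := measure_thickening_lt Z cD e0.
apply: filterS (F0 _ (nbhs_zero_closed_ideal fin a)) => s sa.
have cs := @closed_ideal_closure D n s Z.
have mu_closure_le := le_fine_measure_closed (@closed_closure _ Z) cs
  (@closure_sub_ideal_closure D n s Z).
have mu_le_thickening := le_fine_measure_closed cs (@closed_thickening D n a Z)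
  (ideal_closure_sub_thickening (Z := Z) sa).
rewrite distrC ger0_norm ?subr_ge0// ltrBlDl.
exact: le_lt_trans mu_le_thickening ae.
Qed.

End Measure.

Section Density.
Variables (R : realType) (D : idomainType) (n : nat).
Variables (dp dm : set 'rV[D]_n -> R) (dens : is_density dp dm).
Implicit Types X Y : set 'rV[D]_n.

Lemma densityp_setC X : dp (~` X) = 1 - dm X.
Proof. by rewrite -(densityC dens (setICl X) (setUCl X)) addrK. Qed.

Lemma densitym_setC X : dm (~` X) = 1 - dp X.
Proof. by rewrite -[in dp X](setCK X) densityp_setC subKr. Qed.

Lemma densityp_setD X Y : X `<=` Y -> dp Y = dm Y ->
  dp (Y `\` X) = dp Y - dm X.
Proof.
move=> XY dY; apply/le_anti/andP; split.
  have YX0 : ~` Y `&` X = set0 by rewrite setIC; apply/subsets_disjoint.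
  have := densityUm dens YX0.
  by rewrite -setCD !densitym_setC -addrA lerD2l lerNr opprD opprK.
have YX0 : ~` Y `&` (Y `\` X) = set0 by rewrite setDE setIA setICl set0I.
have := densityUp dens YX0.
rewrite setDE setUIr setUCl setTI -setCI (setIidr XY) !densityp_setC.
by rewrite -addrA lerD2l lerNl opprD opprK dY lerBlDr -lerBlDl.
Qed.

Lemma cvg_density_setD0P (I : Type) (F : set_system I) {FF : ProperFilter F}
    (Y : I -> set 'rV[D]_n) X (m : R) :
  (\forall i \near F, X `<=` Y i /\ dp (Y i) = dm (Y i)) ->
  dp (Y i) @[i --> F] --> m ->
  (dp (Y i `\` X) @[i --> F] --> 0) <-> (dp X = dm X /\ dp X = m).
Proof.
move=> XY Ym.
have dXm : dp X <= m.
  apply: cvgr_to_ge Ym _; apply: filterS XY => i [XYi _].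
  exact: (density_subp dens XYi).
have lim_setD : dp (Y i `\` X) @[i --> F] --> m - dm X.
  apply: cvg_trans (cvgB Ym (cvg_cst (dm X))); apply: near_eq_cvg.
  by apply: filterS XY => i [XYi dYi]; rewrite densityp_setD.
split=> [lim0|[dpm dpX]]; last by rewrite -dpX dpm subrr in lim_setD.
have mE : m = dm X by apply: subr0_eq; exact: cvg_unique lim_setD lim0.
have dpm : dp X = dm X.
  by apply/le_anti; rewrite (density_le dens) -mE dXm.
by rewrite dpm.
Qed.

Lemma cvg_density_ext_setD0P (a : nzideal D) (I : Type) (F : set_system I)
    {FF : ProperFilter F} (A : I -> set 'rV[completion D]_n) X (m : R) :
  ~ a 1 ->
  (\forall i \near F, to_completion_vec @` X `<=` A i /\
     density_ext dp (A i) = density_ext dm (A i)) ->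
  density_ext dp (A i) @[i --> F] --> m ->
  density_ext dp (A i `\` to_completion_vec @` X) @[i --> F] --> (0 : R) <->
  (dp X = dm X /\ dp X = m).
Proof.
move=> /(preimage_image_to_completion_vec X) XE XA Am.
have extE B : density_ext dp (B `\` to_completion_vec @` X) =
    dp (to_completion_vec @^-1` B `\` X) by rewrite -[in RHS]XE.
under eq_fun do rewrite extE; apply: cvg_density_setD0P Am.
apply: filterS XA => i [XAi dAi]; split=> //.
by rewrite -XE; exact: preimage_subset.
Qed.

End Density.

Theorem theorem4p36 (R : realType) (D : idomainType)
    (dedD : dedekind_domain D)
    (countD : countable [set: D])
    (finD : finite_quotients D)
    (n : nat) (n_gt0 : (0 < n)%N)
    (dp dm : set 'rV[D]_n -> R)
    (dens : is_density dp dm)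
    (mu : probability (borel_completion D n) R)
    (haar_mu : is_haar mu)
    (T : set (closed_ideals finD))
    (accT : limit_point T (zero_closed_ideal finD))
    (X : set 'rV[D]_n)
    (densX : forall sigma, T sigma ->
       let Xsigma := ideal_closure sigma (to_completion_vec @` X) in
       density_ext dp Xsigma = density_ext dm Xsigma /\
       (density_ext dp Xsigma)%:E = mu Xsigma) :
  ((fun sigma : closed_ideals finD =>
      density_ext dp (ideal_closure sigma (to_completion_vec @` X)
                        `\` to_completion_vec @` X))
     @ within T ((zero_closed_ideal finD)^') --> (0 : R))
  <->
  (dp X = dm X /\ (dp X)%:E = mu (closure (to_completion_vec @` X))).
Proof.
set Z := to_completion_vec @` X.
have [s0 [/proper_nzideal_ex[a a1] _ _]] := accT _ filterT.
have muZ_fin := fin_num_measure_closed mu (@closed_closure _ Z).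
have FF := within_dnbhs_proper accT.
set F := within T _ in FF *.
have F0 : F --> zero_closed_ideal finD.
  exact: cvg_trans (cvg_within _) (@nbhs_dnbhs _ _).
pose Z_ (s : closed_ideals finD) := ideal_closure s Z.
have densZ : \forall s \near F,
    Z `<=` Z_ s /\ density_ext dp (Z_ s) = density_ext dm (Z_ s).
  apply: filterS (withinT T _) => s /densX[dZs _].
  by split=> //; exact: sub_ideal_closure.
have cvgZ : density_ext dp (Z_ s) @[s --> F] --> fine (mu (closure Z)).
  apply: cvg_trans (cvg_measure_ideal_closure (mu := mu) (Z := Z) countD F0).
  by apply: near_eq_cvg; apply: filterS (withinT T _) => s /densX[_ /= <-].
apply: iff_trans (cvg_density_ext_setD0P dens a1 densZ cvgZ) _.
by rewrite -[in X in _ <-> X](fineK muZ_fin); split=> [[-> ->]|[-> [->]]].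
Qed.
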